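(* Let $\gamma=(\gamma_1,\dots,\gamma_n)$ be a sequence of pairwise distinct elements, let $I^\beta=\{w.\gamma: w\in\mathfrak{S}_n\}$, let $\nu\in I^\beta$ and $u\in\mathfrak{S}_n$. Then $u$ is indecomposable relative to $\nu$ if and only if $u=s_ks_{k+1}\cdots s_t$ for some $1\le k\le t\le n-1$ such that $\nu_k<\nu_{t+1}<\nu_p$ for all $k+1\le p\le t$, that is, $k=\max\{1\le s\le t\mid\nu_s<\nu_{t+1}\}$. In particular, such $u$ is determined uniquely by $\nu$ and $t$, and thus for any $1\le t<n$ there exists at most one such $u$ (of the form $s_k\cdots s_t$) that is indecomposable relative to $\nu$.
   Context: Here $\beta=\alpha_{\gamma_1}+\cdots+\alpha_{\gamma_n}$ is a sum of pairwise distinct simple roots, so that $I^\beta$ is the set of all orderings of $\{\gamma_1,\dots,\gamma_n\}$. The symmetric group $\mathfrak{S}_n$ acts by $w.\nu=(\nu_{w^{-1}(1)},\dots,\nu_{w^{-1}(n)})$; $s_k=(k,k+1)$; $\ell$ is the length function on $\mathfrak{S}_n$. The set $\{\gamma_1,\dots,\gamma_n\}$ is totally ordered by $\gamma_1<\gamma_2<\cdots<\gamma_n$; inequalities such as $\nu_s<\nu_{t+1}$ refer to this order. Total order on $I^\beta$: for $u,v\in\mathfrak{S}_n$, $u\prec v$ iff $(u(1),\dots,u(n))<(v(1),\dots,v(n))$ lexicographically (there is $t$ with $u(t)<v(t)$ and $u(k)=v(k)$ for $k<t$). This is transported to $I^\beta$ via the bijection $\mathfrak{S}_n\to I^\beta$,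 $u\mapsto u.\gamma$: $u.\gamma\prec v.\gamma$ iff $u\prec v$. Definition: let $\nu\in I^\beta$ and $u\in\mathfrak{S}_n$ with $\nu\prec u.\nu$. Then $u$ is *decomposable relative to* $\nu$ if $u=u_1u_2$ with $\ell(u)=\ell(u_1)+\ell(u_2)$, $u_1\ne e$ and $\nu\prec u_2.\nu$; if there is no such decomposition, $u$ is *indecomposable relative to* $\nu$. (In particular ''indecomposable relative to $\nu$'' includes the condition $\nu\prec u.\nu$.) *)

(* Defs.v *)
From mathcomp Require Import all_boot all_fingroup.

Set Implicit Arguments.
Unset Strict Implicit.
Unset Printing Implicit Defensive.

(* MathComp multiplies permutations left to right ((s * t) x = t (s x)); the
   action and the words below use the usual composition of functions,
   [pcomp u v] = u \o v. *)
Definition pcomp (n : nat) (u v : 'S_n) : 'S_n := (v * u)%g.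

Lemma pcompE (n : nat) (u v : 'S_n) (i : 'I_n) : pcomp u v i = u (v i).
Proof. exact: permM. Qed.

(* Positions are numbered from 0. A simple reflection is indexed by
   k : 'I_n.-1 and exchanges the positions [lpos k] = k and [rpos k] = k + 1. *)
Lemma lpos_subproof (n : nat) (k : 'I_n.-1) : k < n.
Proof. exact: leq_trans (ltn_ord k) (leq_pred n). Qed.

Lemma rpos_subproof (n : nat) (k : 'I_n.-1) : k.+1 < n.
Proof. by case: n k => [[]|n k] //; apply: ltn_ord. Qed.

Definition lpos (n : nat) (k : 'I_n.-1) : 'I_n := Ordinal (lpos_subproof k).
Definition rpos (n : nat) (k : 'I_n.-1) : 'I_n := Ordinal (rpos_subproof k).

Definition simple_refl (n : nat) (k : 'I_n.-1) : 'S_n := tperm (lpos k) (rpos k).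

(* [:: i_1; ...; i_l] is sent to s_{i_1} \o ... \o s_{i_l}. *)
Definition word_perm (n : nat) (w : seq 'I_n.-1) : 'S_n :=
  foldr (fun i u => pcomp (simple_refl i) u) 1%g w.

Definition has_word (n : nat) (u : 'S_n) (l : nat) : bool :=
  [exists w : l.-tuple 'I_n.-1, word_perm w == u].

Lemma word_perm_cat (n : nat) (w1 w2 : seq 'I_n.-1) :
  word_perm (w1 ++ w2) = pcomp (word_perm w1) (word_perm w2).
Proof.
rewrite /pcomp; elim: w1 => [|i w1 IH] /=; first by rewrite mulg1.
by rewrite IH /pcomp mulgA.
Qed.

Lemma word_tperm_ltn (n : nat) (d : nat) (x y : 'I_n) :
  y = (x + d).+1 :> nat -> exists w : seq 'I_n.-1, word_perm w = tperm x y.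
Proof.
have lx (z : 'I_n) e : y = (z + e).+1 :> nat -> z < n.-1.
  move=> E; have := ltn_ord y; rewrite E -ltn_predRL.
  exact: leq_ltn_trans (leq_addr _ _).
elim: d x => [|d IH] x yE; pose k := Ordinal (lx x _ yE);
  have kE : lpos k = x by apply/val_inj.
  exists [:: k]; rewrite /= /pcomp mul1g /simple_refl kE.
  by congr tperm; apply/val_inj; rewrite /= yE addn0.
have [w wE] := IH (rpos k) (etrans yE (congr1 S (esym (addSnnS x d)))).
exists (k :: w ++ [:: k]).
rewrite /= word_perm_cat wE /= /pcomp mul1g -mulgA.
have -> : (simple_refl k * (tperm (rpos k) y * simple_refl k))%g
          = (tperm (rpos k) y ^ simple_refl k)%g by rewrite /conjg tpermV.
rewrite tpermJ /simple_refl tpermR kE tpermD // -val_eqE /= yE.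
  by rewrite neq_ltn ltnS leq_addr.
by rewrite eqSS neq_ltn addnS ltnS leq_addr.
Qed.

Lemma has_wordP (n : nat) (u : 'S_n) : exists l, has_word u l.
Proof.
suff [w wE] : exists w, word_perm w = u.
  by exists (size w); apply/existsP; exists (in_tuple w); apply/eqP.
have [ts -> _] := prod_tpermP u.
elim: ts => [|[x y] ts [w wE]]; first by exists [::]; rewrite big_nil.
have [v vE] : exists v, word_perm v = tperm x y.
  wlog ltxy : x y / x < y.
    move=> H; have [/H //|/H [v vE]|/val_inj ->] := ltngtP x y.
      by exists v; rewrite tpermC.
    by exists [::]; rewrite tperm1.
  by apply: (@word_tperm_ltn _ (y - x.+1)); rewrite -addSn subnKC.
by exists (w ++ v); rewrite word_perm_cat big_cons /pcomp wE vE.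
Qed.

Definition perm_length (n : nat) (u : 'S_n) : nat := ex_minn (has_wordP u).

(* The action w.nu = (nu_{w^-1(1)}, ..., nu_{w^-1(n)}). *)
Definition act (n : nat) (T : Type) (w : 'S_n) (nu : n.-tuple T) : n.-tuple T :=
  [tuple tnth nu (w^-1%g i) | i < n].

Definition in_Ibeta (n : nat) (T : Type) (gamma nu : n.-tuple T) : Prop :=
  exists w : 'S_n, nu = act w gamma.

Definition perm_prec (n : nat) (u v : 'S_n) : Prop :=
  exists t : 'I_n, u t < v t /\ (forall k : 'I_n, k < t -> u k = v k).

Definition Ibeta_prec (n : nat) (T : Type) (gamma nu nu' : n.-tuple T) : Prop :=
  exists u v : 'S_n,
    [/\ nu = act u gamma, nu' = act v gamma & perm_prec u v].

(* The order gamma_1 < ... < gamma_n on the entries of gamma. *)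
Definition entry_lt (n : nat) (T : Type) (gamma : n.-tuple T) (a b : T) : Prop :=
  exists i j : 'I_n, [/\ a = tnth gamma i, b = tnth gamma j & i < j].

Definition decomposable (n : nat) (T : Type) (gamma nu : n.-tuple T)
    (u : 'S_n) : Prop :=
  Ibeta_prec gamma nu (act u nu) /\
  exists u1 u2 : 'S_n,
    [/\ u = pcomp u1 u2,
        perm_length u = perm_length u1 + perm_length u2,
        u1 <> 1%g
      & Ibeta_prec gamma nu (act u2 nu)].

Definition indecomposable (n : nat) (T : Type) (gamma nu : n.-tuple T)
    (u : 'S_n) : Prop :=
  Ibeta_prec gamma nu (act u nu) /\ ~ decomposable gamma nu u.

(* s_k s_{k+1} ... s_t *)
Definition refl_segment (n : nat) (k t : 'I_n.-1) : 'S_n :=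
  word_perm [seq i : 'I_n.-1 <- enum 'I_n.-1 | k <= i <= t].

(* nu_k < nu_{t+1} < nu_p for all k + 1 <= p <= t; the first inequality is
   required even when k = t and there is no p. *)
Definition segment_cond (n : nat) (T : Type) (gamma nu : n.-tuple T)
    (k t : 'I_n.-1) : Prop :=
  entry_lt gamma (tnth nu (lpos k)) (tnth nu (rpos t)) /\
  (forall p : 'I_n, k < p <= t ->
     entry_lt gamma (tnth nu (rpos t)) (tnth nu p)).

(* k = max {s <= t | nu_s < nu_{t+1}}, where in particular the set is
   nonempty. *)
Definition is_max_below (n : nat) (T : Type) (gamma nu : n.-tuple T)
    (k t : 'I_n.-1) : Prop :=
  [/\ k <= t,
      entry_lt gamma (tnth nu (lpos k)) (tnth nu (rpos t))
    & forall s : 'I_n.-1, s <= t ->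
        entry_lt gamma (tnth nu (lpos s)) (tnth nu (rpos t)) -> s <= k].

(* Main.v *)
From mathcomp Require Import all_boot all_fingroup zify.
Require Import Defs.

Set Implicit Arguments.
Unset Strict Implicit.
Unset Printing Implicit Defensive.

(** The position of each entry of [gamma] in [nu = act w gamma] is recorded by
    [w], so the order [gamma_1 < ... < gamma_n] ranks the positions of [nu] by
    [r = w^-1], and [nu] precedes [u.nu] exactly when, among the positions moved
    by [u], the one of smallest rank moves to the right ([rises], in
    [Ibeta_prec_act]).  All the rest is about ranks, moves and inversions.

    The length of a permutation is its number of inversions, and a product
    [u1 u2] has additive length exactly when every inversion of [u2] is one of
    [u1 u2] ([perm_length_pcomp]).  Decomposing [u] thus means finding a smaller
    set of inversions that still belongs to a permutation that rises.  The
    segment [s_k ... s_t] carries position [t+1] to [k] and shifts the positions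
    in between by one; its inversions are the pairs [(p, t+1)] with
    [k <= p <= t].

    Every [u] that rises contains such a segment ([exists_sub_refl_segment]).
    Let [p] be the moved position of smallest rank.  As [u] sends [p] to the
    right, some position after [p] must land at or before [p]; let [j] be the
    first one.  All positions from [p] to [j-1] land after [p], hence are
    inverted with [j], and [j] is moved, so it has a larger rank than [p].
    Starting the segment at the last [i < j] of smaller rank than [j] gives the
    rank condition, and the segment that brings [j] back to [i] has all its
    inversions in [u].  An indecomposable [u] is therefore equal to it.

    Conversely, such a segment is indecomposable ([rises_sub_refl_segment]):
    if [v] rises and all its inversions are pairs [(p, t+1)] of the segment,
    then its moved position of smallest rank is inverted with [t+1], hence lies
    in [k, ..., t] and has smaller rank than [t+1]: it is [k].  Since [v] keeps
    the order of [k, ..., t], all of these jump over the image of [t+1], and [v]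
    has all the inversions of the segment; the complementary factor has
    length 0.

    Uniqueness holds since [t] can be read off the segment ([refl_segment_inj])
    and [k] is then a maximum determined by [nu] and [t]. *)

(** * Inversions and length *)

(** Pigeonhole: otherwise [u] would send all the positions from [p] on into
    those strictly after [p]. *)
Lemma exists_crossing (n : nat) (u : 'S_n) (p : 'I_n) :
  p < u p -> exists j : 'I_n, (p < j) && (u j <= p).
Proof.
move=> ltpu; apply/existsP; apply: contraT; rewrite negb_exists => /forallP no.
pose A := [set j : 'I_n | p < j].
have : u @: (p |: A) \subset A.
  apply/subsetP=> _ /imsetP[j + ->]; rewrite !inE => /orP[/eqP->//|ltpj].
  by move: (no j); rewrite ltpj /= -ltnNge.
move/subset_leq_card; rewrite (card_imset _ (@perm_inj _ u)) cardsU1 inE.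
by rewrite ltnn ltnn.
Qed.

(** Each inverted pair is recorded in both orders.  Membership is then an
    exclusive or that is compatible with composition without sorting the pair
    of images, at the price of a factor 2 in cardinalities. *)
Definition inversions (n : nat) (u : 'S_n) : {set 'I_n * 'I_n} :=
  [set x : 'I_n * 'I_n | (x.1 < x.2) (+) (u x.1 < u x.2)].

Lemma mem_inversions (n : nat) (u : 'S_n) (i j : 'I_n) :
  i < j -> ((i, j) \in inversions u) = (u j < u i).
Proof.
move=> ltij; rewrite inE /= ltij /= -leqNgt leq_eqVlt.
case: eqP => //= /val_inj/perm_inj eji; by rewrite eji ltnn in ltij.
Qed.

Lemma inversions_sym (n : nat) (u : 'S_n) (i j : 'I_n) :
  ((i, j) \in inversions u) = ((j, i) \in inversions u).
Proof.
rewrite !inE /=; have [->|neq] := eqVneq i j; first by [].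
have neqv : u i != u j by rewrite (inj_eq perm_inj).
by move: neq neqv; rewrite -!val_eqE /=; lia.
Qed.

Lemma inversions_subP (n : nat) (u v : 'S_n) :
  reflect (forall i j : 'I_n, i < j -> u j < u i -> v j < v i)
          (inversions u \subset inversions v).
Proof.
apply: (iffP subsetP) => [sub i j ij|sub [i j]].
  by move: (sub (i, j)); rewrite !mem_inversions.
have [ij|ij|/val_inj->] := ltngtP i j; last by rewrite !inE /= !ltnn.
  by rewrite !mem_inversions //; apply: sub.
by rewrite ![(i, j) \in _]inversions_sym !mem_inversions //; apply: sub.
Qed.

(** The cardinality of a symmetric difference [C] of [A] and [B], whose
    intersection is [A :\: C]. *)
Lemma card_addb_sets (T : finType) (A B C : {set T}) :
    (forall x, (x \in C) = (x \in A) (+) (x \in B)) ->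
  #|C| + #|A :\: C|.*2 = #|B| + #|A|.
Proof.
move=> memC.
have -> : A :\: C = A :&: B.
  by apply/setP=> x; rewrite !(in_setD, in_setI) memC; do 2! case: (_ \in _).
have := cardsID A C; have := cardsID A B.
have -> : C :\: A = B :\: A.
  by apply/setP=> x; rewrite !in_setD memC; do 2! case: (_ \in _).
have -> : C :&: A = A :\: B.
  by apply/setP=> x; rewrite !(in_setD, in_setI) memC; do 2! case: (_ \in _).
by have := cardsID B A; rewrite [B :&: A]setIC; lia.
Qed.

(** A pair is inverted by [u \o v] iff exactly one of the two factors inverts
    it, [u] acting on the image of the pair under [v]. *)
Lemma inversions_pcomp (n : nat) (u v : 'S_n) :
  #|inversions (pcomp u v)| + #|inversions v :\: inversions (pcomp u v)|.*2
    = #|inversions u| + #|inversions v|.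
Proof.
set A := inversions v; set C := inversions (pcomp u v).
pose v2 (x : 'I_n * 'I_n) := (v x.1, v x.2).
have v2_inj : injective v2 by move=> [a b] [c d] [/perm_inj-> /perm_inj->].
pose B := v2 @^-1: inversions u.
have <- : #|B| = #|inversions u|.
  rewrite on_card_preimset //; exists (fun x => (v^-1%g x.1, v^-1%g x.2)).
    by move=> [a b] _; rewrite /v2 /= !permK.
  by move=> [a b] _; rewrite /v2 /= !permKV.
have memC x : (x \in C) = (x \in A) (+) (x \in B).
  by rewrite !inE !pcompE /=; do 3! case: (_ < _).
exact: card_addb_sets memC.
Qed.

Lemma inversions1 (n : nat) : inversions (1%g : 'S_n) = set0.
Proof. by apply/setP=> x; rewrite !inE !perm1 addbb. Qed.

(** With no inversion, [exists_crossing] forbids [u] to move anything to the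
    right; the same holds for the inverse. *)
Lemma inversions_eq0 (n : nat) (u : 'S_n) : inversions u = set0 -> u = 1%g.
Proof.
move=> u0; have le_of (v : 'S_n) p : inversions v = set0 -> v p <= p.
  move=> v0; rewrite leqNgt; apply/negP => ltp.
  have [j /andP[pj vj]] := exists_crossing ltp.
  have := mem_inversions v pj; rewrite v0 inE => /esym/negbT/negP[].
  exact: leq_ltn_trans vj ltp.
have u'0 : inversions u^-1%g = set0.
  have := inversions_pcomp u^-1 u; rewrite /pcomp mulgV inversions1 u0 set0D.
  by rewrite !cards0 addn0 => /esym/cards0_eq.
apply/permP=> p; apply/val_inj/eqP; rewrite perm1 eqn_leq le_of //=.
by have := le_of _ (u p) u'0; rewrite permK.
Qed.

(** Some inversion [(i, j)] exists; walking from [i] to [j], the first step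
    either is a descent or leaves a shorter inversion. *)
Lemma exists_descent (n : nat) (u : 'S_n) :
  u != 1%g -> exists k : 'I_n.-1, u (rpos k) < u (lpos k).
Proof.
move=> u1; have /set0Pn[[i j]] : inversions u != set0.
  by apply: contra_neq u1; apply: inversions_eq0.
wlog ltij : i j / i < j => [H|].
  have [ij|ij|/val_inj->] := ltngtP i j; first exact: H.
    by rewrite inversions_sym; apply: H.
  by rewrite !inE /= !ltnn.
rewrite mem_inversions //.
elim: {i}(j - i).-1 {-2}i (erefl (j - i).-1) ltij => [|d IH] i dE ltij uji.
  have lti : i < n.-1 by have := ltn_ord j; lia.
  exists (Ordinal lti).
  have -> : rpos (Ordinal lti) = j by apply/val_inj => /=; lia.
  by have -> : lpos (Ordinal lti) = i by apply/val_inj.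
have lti : i < n.-1 by have := ltn_ord j; lia.
have lposE : lpos (Ordinal lti) = i by apply/val_inj.
have [desc|le] := ltnP (u (rpos (Ordinal lti))) (u (lpos (Ordinal lti))).
  by exists (Ordinal lti).
apply: (IH (rpos (Ordinal lti))) => /=; [lia|lia|].
by apply: leq_trans le; rewrite lposE.
Qed.

Lemma inversions_simple_refl (n : nat) (k : 'I_n.-1) :
  inversions (simple_refl k) = [set (lpos k, rpos k); (rpos k, lpos k)].
Proof.
apply/setP=> [[i j]]; rewrite !inE /= !xpair_eqE -!val_eqE /simple_refl.
by do 2! (case: tpermP => [->|->|/eqP + /eqP]; rewrite -?val_eqE /=); lia.
Qed.

Lemma card_inversions_simple_refl (n : nat) (k : 'I_n.-1) :
  #|inversions (simple_refl k)| = 2.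
Proof.
by rewrite inversions_simple_refl cards2 xpair_eqE -!val_eqE /=; lia.
Qed.

(** Composing with one reflection adds at most one inversion, so that a word is
    at least as long as the number of inversions.  Conversely a descent [k] of
    [u] lets one write [u = u' s_k] with one inversion less, which builds a word
    of that size. *)
Lemma perm_lengthE (n : nat) (u : 'S_n) :
  (perm_length u).*2 = #|inversions u|.
Proof.
rewrite /perm_length; case: ex_minnP => l /existsP[w /eqP wu] lmin.
apply/eqP; rewrite eqn_leq; apply/andP; split; last first.
  rewrite -wu; have := size_tuple w; move: (tval w) => {wu lmin}w <-.
  elim: w => [|k w IH]; first by rewrite inversions1 cards0.
  have := eq_leq (inversions_pcomp (simple_refl k) (word_perm w)).
  rewrite card_inversions_simple_refl => /(leq_trans (leq_addr _ _)) leE.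
  by apply: leq_trans leE _.
suff [m m2 um] : exists2 m, m.*2 <= #|inversions u| & has_word u m.
  by apply: leq_trans m2; rewrite leq_double lmin.
(* Induction on a strict bound on the number of inversions. *)
elim: {w wu lmin}_.+1 {-2}u (ltnSn #|inversions u|) => // N IH v vN.
have [->|v1] := eqVneq v 1%g.
  by exists 0 => //; apply/existsP; exists [tuple].
have [k desc] := exists_descent v1.
have vE : v = pcomp (pcomp v (simple_refl k)) (simple_refl k).
  by apply/permP=> x; rewrite !pcompE tpermK.
have sub : inversions (simple_refl k) \subset inversions v.
  rewrite inversions_simple_refl subUset !sub1set [X in _ && X]inversions_sym.
  by rewrite andbb mem_inversions /=.
have := inversions_pcomp (pcomp v (simple_refl k)) (simple_refl k).
rewrite -vE card_inversions_simple_refl.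
have /eqP -> : inversions (simple_refl k) :\: inversions v == set0.
  by rewrite setD_eq0.
rewrite cards0 addn0 => cardE.
have [|m m2 /existsP[w /eqP wE]] := IH (pcomp v (simple_refl k)); first by lia.
exists m.+1; first by lia.
apply/existsP; exists [tuple of rcons w k]; apply/eqP.
by rewrite [RHS]vE -wE /= -cats1 word_perm_cat /= /pcomp mul1g.
Qed.

(** Additivity fails by the pairs that [v] inverts and [u] turns back. *)
Lemma perm_length_pcomp (n : nat) (u v : 'S_n) :
  perm_length (pcomp u v) = perm_length u + perm_length v <->
  inversions v \subset inversions (pcomp u v).
Proof.
rewrite -setD_eq0 -cards_eq0; have := inversions_pcomp u v.
by rewrite -!perm_lengthE; split=> [|/eqP]; lia.
Qed.

(** * The segments of simple reflections *)

(** The words are taken with letters [k, ..., k + d] so that removing the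
    leftmost reflection leaves a word of the same shape.  That reflection is
    applied last: it brings to [k] the position [k + d + 1], already at [k + 1],
    and sends [k], not moved so far, to [k + 1]. *)
Lemma word_perm_iota (n d k : nat) (w : seq 'I_n.-1) (x : 'I_n) :
    map val w = iota k d.+1 ->
  word_perm w x =
    (if x == (k + d).+1 :> nat then k
     else if k <= x <= k + d then x.+1 else x) :> nat.
Proof.
elim: d k w => [|d IH] k [|i w] //= [ik wE].
  case: w wE => // _; rewrite pcompE perm1 /simple_refl.
  case: tpermP => [->|->|/eqP + /eqP];
    by rewrite -?val_eqE /=; do ?case: ifP; lia.
rewrite pcompE; have := IH _ _ wE.
set y := word_perm w x.
rewrite /simple_refl; case: tpermP => [->|->|/eqP + /eqP];
  by rewrite -?val_eqE /=; do ?case: ifP; lia.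
Qed.

Lemma refl_segmentE (n : nat) (k t : 'I_n.-1) (x : 'I_n) : k <= t ->
  refl_segment k t x =
    (if x == t.+1 :> nat then val k
     else if k <= x <= t then x.+1 else x) :> nat.
Proof.
move=> kt; rewrite -{1 2}(subnKC kt); apply: word_perm_iota.
transitivity [seq i <- map val (enum 'I_n.-1) | k <= i <= t].
  by rewrite filter_map.
rewrite val_enum_ord; apply: (irr_sorted_eq ltn_trans ltnn) => [||i].
- exact/sorted_filter/iota_ltn_sorted/ltn_trans.
- exact: iota_ltn_sorted.
by rewrite mem_filter !mem_iota; have := ltn_ord t; lia.
Qed.

Lemma refl_segment_inversions (n : nat) (k t : 'I_n.-1) (i j : 'I_n) :
  k <= t -> i < j ->
  (refl_segment k t j < refl_segment k t i) = (k <= i) && (j == rpos t).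
Proof.
move=> kt ij; rewrite !refl_segmentE // -val_eqE /=.
by do ?case: ifP; lia.
Qed.

(** * Segments contained in a permutation that rises *)

(** The order on the orbit, read on positions: [r] ranks the positions, and the
    position of smallest rank among those moved by [u] goes to the right. *)
Definition rises (n : nat) (r u : 'S_n) : Prop :=
  exists p : 'I_n, p < u p /\ forall q : 'I_n, r q < r p -> u q = q.

Definition segment_ranks (n : nat) (r : 'S_n) (k t : 'I_n.-1) : Prop :=
  r (lpos k) < r (rpos t) /\
  forall p : 'I_n, k < p <= t -> r (rpos t) < r p.

(** A position that jumps over [p] is moved, and [p] has the smallest rank among
    the moved positions. *)
Lemma crossing_rank (n : nat) (r u : 'S_n) (p j : 'I_n) :
    (forall q : 'I_n, r q < r p -> u q = q) -> p < j -> u j <= p ->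
  r p < r j.
Proof.
move=> fix_low pj uj.
have [//|/fix_low uE|/val_inj/perm_inj pE] := ltngtP (r p) (r j).
  by move: uj; rewrite uE leqNgt pj.
by move: pj; rewrite pE ltnn.
Qed.

Lemma rises_refl_segment (n : nat) (r : 'S_n) (k t : 'I_n.-1) :
  k <= t -> segment_ranks r k t -> rises r (refl_segment k t).
Proof.
move=> kt [rkt rp]; exists (lpos k); split=> [|q rq].
  by rewrite refl_segmentE //=; do ?case: ifP; lia.
apply/val_inj; rewrite /= refl_segmentE //; case: ifP => [/eqP qt|qt].
  have qE : q = rpos t by apply/val_inj.
  by move: rq; rewrite qE => rq; lia.
case: ifP => // /andP[kq qt'].
have qk : q != lpos k by apply: contraL rq => /eqP->; rewrite ltnn.
have : r (rpos t) < r q by apply: rp; move: qk; rewrite -val_eqE /=; lia.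
lia.
Qed.

(** Below a segment satisfying the rank condition for the weak order, only the
    segment itself rises.  The moved position [p] of smallest rank is crossed by
    some [j], which must be [t+1]; comparing ranks gives [p = k].  No pair
    within [k, ..., t] is inverted, so the whole block follows [k] over [t+1]. *)
Lemma rises_sub_refl_segment (n : nat) (r v : 'S_n) (k t : 'I_n.-1) :
    k <= t -> segment_ranks r k t -> rises r v ->
    inversions v \subset inversions (refl_segment k t) ->
  inversions (refl_segment k t) \subset inversions v.
Proof.
move=> kt [rkt rp] [p [ltp fix_low]] /inversions_subP sub.
have [j /andP[pj vj]] := exists_crossing ltp.
have := sub _ _ pj (leq_ltn_trans vj ltp).
rewrite refl_segment_inversions // => /andP[kp /eqP jE].
have rpj := crossing_rank fix_low pj vj; rewrite {}jE in vj pj rpj.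
have pE : p = lpos k.
  apply/val_inj => /=; apply/eqP; rewrite eqn_leq kp leqNgt andbT.
  by apply/negP=> kp'; have := rp p; move: pj => /=; lia.
rewrite {}pE in ltp vj pj rpj fix_low kp.
apply/inversions_subP=> i j' ij; rewrite refl_segment_inversions //.
case/andP=> ki /eqP j'E; rewrite {j'}j'E in ij *.
have [ik|ik|/val_inj ->] := ltngtP i (lpos k).
- by move: ik => /=; lia.
- have [le|lt] := leqP (v i) (v (lpos k)); last first.
    by apply: leq_ltn_trans vj (ltn_trans ltp lt).
  have lti : v i < v (lpos k).
    rewrite ltn_neqAle le andbT; apply: contraTneq ik.
    by move=> /val_inj/perm_inj->; rewrite ltnn.
  have := sub _ _ ik lti; rewrite refl_segment_inversions // leqnn /=.
  by move=> /eqP iE; move: ij; rewrite iE; lia.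
- exact: leq_ltn_trans vj ltp.
Qed.

(** Here [p] is the moved position of smallest rank, [j] the first position
    after it that lands at or before it, and [i] the last position before [j]
    with a smaller rank.  Choosing [j] first puts every position of [[p, j)]
    after [u j]; choosing [i] last gives the rank condition. *)
Lemma exists_sub_refl_segment (n : nat) (r u : 'S_n) :
    rises r u ->
  exists k t : 'I_n.-1, [/\ k <= t, segment_ranks r k t
    & inversions (refl_segment k t) \subset inversions u].
Proof.
move=> [p [ltp fix_low]]; have [j0 j0P] := exists_crossing ltp.
pose crosses (j : 'I_n) := (p < j) && (u j <= p).
case: (@arg_minnP _ j0 crosses (fun j : 'I_n => j) j0P).
move=> j /andP[pj uj] jmin {j0 j0P}.
have above (q : 'I_n) : p <= q -> q < j -> p < u q.
  rewrite leq_eqVlt => /orP[/eqP/val_inj<- //|pq] qj.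
  rewrite ltnNge; apply/negP => uq.
  by have := jmin q; rewrite /crosses pq uq => /(_ isT); lia.
pose low (s : 'I_n) := (s < j) && (r s < r j).
have low_p : low p by rewrite /low pj (crossing_rank fix_low).
case: (@arg_maxnP _ p low (fun s : 'I_n => s) low_p) => i /andP[ij rij] imax.
have pi := imax _ low_p.
have ltk : i < n.-1 by have := ltn_ord j; lia.
have ltt : j.-1 < n.-1 by have := ltn_ord j; lia.
have kE : lpos (Ordinal ltk) = i by apply/val_inj.
have tE : rpos (Ordinal ltt) = j by apply/val_inj => /=; lia.
have kt : Ordinal ltk <= Ordinal ltt by rewrite /=; lia.
exists (Ordinal ltk), (Ordinal ltt); split=> //.
  rewrite /segment_ranks kE tE /=; split=> // q /andP[iq qj].
  have qj' : q < j by lia.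
  have [//|rqj|/val_inj/perm_inj qE] := ltngtP (r j) (r q).
    by have := imax q; rewrite /low qj' rqj => /(_ isT) /=; lia.
  by move: qj'; rewrite qE ltnn.
apply/inversions_subP=> a b ab; rewrite refl_segment_inversions // tE.
case/andP=> /= ia /eqP bE; rewrite bE in ab *.
by apply: leq_ltn_trans uj (above _ _ ab); apply: leq_trans pi ia.
Qed.

(** * From sequences to ranks *)

Lemma tnth_act (n : nat) (T : Type) (w : 'S_n) (nu : n.-tuple T) (i : 'I_n) :
  tnth (act w nu) i = tnth nu (w^-1%g i).
Proof. by rewrite tnth_mktuple. Qed.

Lemma act_pcomp (n : nat) (T : Type) (u v : 'S_n) (nu : n.-tuple T) :
  act (pcomp u v) nu = act u (act v nu).
Proof. by apply: eq_from_tnth => i; rewrite !tnth_act /pcomp invMg permM. Qed.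

Lemma act_inj (n : nat) (T : Type) (gamma : n.-tuple T) :
  injective (tnth gamma) -> injective (fun w => act w gamma).
Proof.
move=> gamma_inj u v /(congr1 (fun nu => tnth nu)) uvE.
apply: invg_inj; apply/permP => i; apply: gamma_inj.
by rewrite -!tnth_act uvE.
Qed.

(** The first place [t] where [w] and [u \o w] differ is the rank of the
    position [p = w t], the moved position of smallest rank. *)
Lemma Ibeta_prec_act (n : nat) (T : Type) (gamma : n.-tuple T) (w u : 'S_n) :
    injective (tnth gamma) ->
  Ibeta_prec gamma (act w gamma) (act u (act w gamma)) <-> rises w^-1%g u.
Proof.
move=> gamma_inj; rewrite -act_pcomp; split=> [[w' [v []]]|[p [ltp fix_low]]].
  move=> /(act_inj gamma_inj)<- /(act_inj gamma_inj)<- [t [ltt eq_below]].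
  exists (w t); rewrite permK -pcompE; split=> // q qt.
  by have := eq_below _ qt; rewrite pcompE permKV.
exists w, (pcomp u w); split=> //; exists (w^-1%g p).
rewrite pcompE permKV; split=> // q qp.
by rewrite pcompE fix_low // permK.
Qed.

Lemma entry_lt_act (n : nat) (T : Type) (gamma : n.-tuple T) (w : 'S_n)
    (i j : 'I_n) :
    injective (tnth gamma) ->
  entry_lt gamma (tnth (act w gamma) i) (tnth (act w gamma) j) <->
  w^-1%g i < w^-1%g j.
Proof.
move=> gamma_inj; rewrite !tnth_act; split=> [[a [b []]]|lt].
  by move=> /gamma_inj-> /gamma_inj->.
by exists (w^-1%g i), (w^-1%g j).
Qed.

Lemma segment_cond_act (n : nat) (T : Type) (gamma : n.-tuple T) (w : 'S_n)
    (k t : 'I_n.-1) :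
    injective (tnth gamma) ->
  segment_cond gamma (act w gamma) k t <-> segment_ranks w^-1%g k t.
Proof.
move=> gamma_inj; split=> -[rkt rp]; split=> [|p kp];
  by apply/(entry_lt_act w _ _ gamma_inj) => //; apply: rp.
Qed.

(** Entries are distinct, so [k] being the last position up to [t] of rank
    smaller than that of [t+1] says that all later ones have larger rank. *)
Lemma is_max_below_act (n : nat) (T : Type) (gamma : n.-tuple T) (w : 'S_n)
    (k t : 'I_n.-1) :
    injective (tnth gamma) -> k <= t ->
  is_max_below gamma (act w gamma) k t <-> segment_ranks w^-1%g k t.
Proof.
move=> gamma_inj kt; have ltE := entry_lt_act w _ _ gamma_inj.
split=> [[_ /ltE rkt kmax]|[rkt rp]]; split=> //.
- move=> p /andP[kp pt]; have ltp : p < n.-1 by have := ltn_ord t; lia.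
  have pE : lpos (Ordinal ltp) = p by apply/val_inj.
  have [//|rpt|/val_inj/perm_inj ptE] := ltngtP (w^-1%g (rpos t)) (w^-1%g p).
    have := kmax (Ordinal ltp) pt; rewrite pE => /(_ (proj2 (ltE _ _) rpt)) /=.
    by rewrite leqNgt kp.
  by move: pt; rewrite -ptE /= ltnn.
- exact/ltE.
move=> s st /ltE rst; rewrite leqNgt; apply/negP => ks.
by have := rp (lpos s); rewrite /= ks st => /(_ isT); lia.
Qed.

(** If [u] contains a segment [c] that rises, then [u = (u c^-1) c] has additive
    length, so indecomposability forces [u = c].  In the other direction, a
    factor [u2] of a segment that rises has all its inversions, and the other
    factor [u1] is left with none. *)
Lemma indecomposable_act (n : nat) (T : Type) (gamma : n.-tuple T)
    (w u : 'S_n) :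
    injective (tnth gamma) ->
  indecomposable gamma (act w gamma) u <->
  exists k t : 'I_n.-1,
    [/\ k <= t, u = refl_segment k t & segment_ranks w^-1%g k t].
Proof.
move=> gamma_inj; have precE v := Ibeta_prec_act w v gamma_inj.
split=> [[uP indec]|[k [t [kt -> ranks]]]].
  have [k [t [kt ranks sub]]] := exists_sub_refl_segment (proj1 (precE u) uP).
  set c := refl_segment k t in sub.
  exists k, t; split=> //; apply/eqP; apply: contra_notT indec => uc.
  have uE : u = pcomp (pcomp u c^-1) c by rewrite /pcomp mulKVg.
  split=> //; exists (pcomp u c^-1), c; split=> //.
  - by rewrite {1}uE; apply/perm_length_pcomp; rewrite -uE.
  - by move=> u1; move: uc; rewrite uE u1 /pcomp mulg1 eqxx.
  - by apply/precE/rises_refl_segment.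
have cP := rises_refl_segment kt ranks.
split; first exact/precE.
case=> _ [u1 [u2 [cE lenE u1N /precE u2P]]]; apply: u1N.
move: lenE; rewrite cE => lenE; have /perm_length_pcomp := lenE.
rewrite -cE => sub; have sub' := rises_sub_refl_segment kt ranks u2P sub.
have invE : inversions u2 = inversions (pcomp u1 u2).
  by rewrite -cE; apply/eqP; rewrite eqEsubset sub.
apply: inversions_eq0; apply/cards0_eq; rewrite -perm_lengthE.
move: lenE (perm_lengthE u2); rewrite invE -perm_lengthE; lia.
Qed.

(** Both ends are read off the inversion [(k, t+1)] of the first segment and the
    inversion [(k', t'+1)] of the second. *)
Lemma refl_segment_inj (n : nat) (k t k' t' : 'I_n.-1) :
    k <= t -> k' <= t' -> refl_segment k t = refl_segment k' t' ->
  k = k' /\ t = t'.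
Proof.
move=> kt kt' E.
have lt_rpos : lpos k < rpos t by rewrite /=; lia.
have := refl_segment_inversions kt lt_rpos.
rewrite E refl_segment_inversions // leqnn eqxx => /andP[/= le1 /eqP tE].
have {}tE : t = t' by apply/val_inj; case: tE.
split=> //; have lt_rpos' : lpos k' < rpos t by rewrite /= tE; lia.
have := refl_segment_inversions kt lt_rpos'.
rewrite E refl_segment_inversions // tE leqnn eqxx => /esym/andP[/= le2 _].
by apply/val_inj/eqP; rewrite eqn_leq le1 le2.
Qed.

Theorem lemma4p5 (n : nat) (T : Type) (gamma : n.-tuple T)
    (gamma_inj : injective (tnth gamma))
    (nu : n.-tuple T) (nu_Ibeta : in_Ibeta gamma nu) (u : 'S_n) :
  [/\ indecomposable gamma nu u <->
        (exists k t : 'I_n.-1,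
           [/\ k <= t, u = refl_segment k t & segment_cond gamma nu k t]),
      forall k t : 'I_n.-1, k <= t ->
        (segment_cond gamma nu k t <-> is_max_below gamma nu k t),
      forall (t : 'I_n.-1) (v v' : 'S_n),
        (exists k : 'I_n.-1,
           [/\ k <= t, v = refl_segment k t & segment_cond gamma nu k t]) ->
        (exists k : 'I_n.-1,
           [/\ k <= t, v' = refl_segment k t & segment_cond gamma nu k t]) ->
        v = v'
    & forall (t : 'I_n.-1) (v v' : 'S_n),
        (exists k : 'I_n.-1, k <= t /\ v = refl_segment k t) ->
        indecomposable gamma nu v ->
        (exists k : 'I_n.-1, k <= t /\ v' = refl_segment k t) ->
        indecomposable gamma nu v' ->
        v = v'].
Proof.
case: nu_Ibeta => w {nu}->.
have condE k t := segment_cond_act w k t gamma_inj.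
have indecE v : indecomposable gamma (act w gamma) v <->
    exists k t : 'I_n.-1, [/\ k <= t, v = refl_segment k t
      & segment_cond gamma (act w gamma) k t].
  apply: iff_trans (indecomposable_act w v gamma_inj) _.
  by split=> -[k [t [kt vE /condE]]]; exists k, t.
have maxE (k t : 'I_n.-1) : k <= t -> segment_cond gamma (act w gamma) k t <->
    is_max_below gamma (act w gamma) k t.
  move=> kt; apply: iff_trans (condE k t) _.
  exact: iff_sym (is_max_below_act w gamma_inj kt).
have uniq (t : 'I_n.-1) (v v' : 'S_n) :
    (exists k : 'I_n.-1, [/\ k <= t, v = refl_segment k t
       & segment_cond gamma (act w gamma) k t]) ->
    (exists k : 'I_n.-1, [/\ k <= t, v' = refl_segment k t
       & segment_cond gamma (act w gamma) k t]) ->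
    v = v'.
  move=> [k [kt -> /(maxE _ _ kt)[_ rk kmax]]].
  move=> [k' [kt' -> /(maxE _ _ kt')[_ rk' kmax']]].
  congr refl_segment; apply/val_inj/eqP.
  by rewrite eqn_leq kmax // kmax'.
have last (t : 'I_n.-1) (v : 'S_n) :
    (exists k : 'I_n.-1, k <= t /\ v = refl_segment k t) ->
    indecomposable gamma (act w gamma) v ->
    exists k : 'I_n.-1, [/\ k <= t, v = refl_segment k t
      & segment_cond gamma (act w gamma) k t].
  move=> [k [kt vE]] /indecE[k' [t' [kt' vE' cond]]].
  have [] := refl_segment_inj kt kt' (etrans (esym vE) vE').
  by move=> _ tE; exists k'; rewrite tE.
split=> // t v v' seg indec seg' indec'.
by apply: uniq (last _ _ seg indec) (last _ _ seg' indec').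
Qed.
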